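(* There is a universal constant $c>0$ such that the following holds. Let $\Omega\subset\mathbb R^d$ be compact, $\mu$ a probability measure on $\Omega$, $X_N$ an $N$-dimensional subspace of $\mathcal C(\Omega)$, $q\in[2,\infty)$, and $H>0$ such that $\|f\|_\infty\le H\|f\|_q$ for all $f\in X_N$. Let $\delta\in(0,1)$. Then for every integer $m\ge c\delta^{-2}q^2H^qN$, if $\xi^1,\dots,\xi^m$ are independent random points in $\Omega$ with distribution $\mu$, $$ \mathbb P\Big(\frac12\|f\|_q^q\le\frac1m\sum_{j=1}^m|f(\xi^j)|^q\le\frac32\|f\|_q^q\quad\forall f\in X_N\Big)\ge1-\delta. $$ In particular, there exist $m$ points $\xi^1,\dots,\xi^m\in\Omega$ such that $\frac12\|f\|_q^q\le\frac1m\sum_{j=1}^m|f(\xi^j)|^q\le\frac32\|f\|_q^q$ for all $f\in X_N$.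
   Context: $\|f\|_q=(\int_\Omega|f|^qd\mu)^{1/q}$ and $\|f\|_\infty=\max_{\mathbf x\in\Omega}|f(\mathbf x)|$. *)

(* Defs.v *)
From HB Require Import structures.
From mathcomp Require Import all_boot all_order all_algebra.
From mathcomp Require Import all_classical all_reals all_analysis.
Set Implicit Arguments. Unset Strict Implicit. Unset Printing Implicit Defensive.
Import Order.TTheory GRing.Theory Num.Theory.
Import numFieldNormedType.Exports.
Local Open Scope classical_set_scope.
Local Open Scope ring_scope.

(* Euclidean space R^d, i.e. row vectors 'rV[R]_d, equipped with its Borel
   sigma-algebra (the sigma-algebra generated by the open sets of the usual
   topology on 'rV[R]_d).  Rd R d is convertible to 'rV[R]_d. *)
Definition Rd (R : realType) (d : nat) :=
  g_sigma_algebraType (@open ('rV[R]_d)).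

(* ||f||_q^q = \int_Omega |f|^q dmu  (a real number; finite for the continuous
   functions on compact Omega that we consider). *)
Definition qpow (R : realType) (d : nat)
    (mu : {measure set (Rd R d) -> \bar R}) (Omega : set 'rV[R]_d) (q : R)
    (f : 'rV[R]_d -> R) : R :=
  fine (\int[mu]_(x in (Omega : set (Rd R d))) ((`|f x| `^ q)%:E))%E.

Definition qnorm (R : realType) (d : nat)
    (mu : {measure set (Rd R d) -> \bar R}) (Omega : set 'rV[R]_d) (q : R)
    (f : 'rV[R]_d -> R) : R :=
  qpow mu Omega q f `^ q^-1.

(* Mutual independence of a finite family of random variables X_0..X_{m-1}:
   the product rule for every choice of measurable sets (taking B j = setT
   yields the product rule for every subfamily). *)
Definition mutually_independent (R : realType) (dT : measure_display)
    (T : measurableType dT) (P : probability T R)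
    (dU : measure_display) (U : measurableType dU) (m : nat)
    (X : 'I_m -> T -> U) : Prop :=
  forall B : 'I_m -> set U, (forall j, measurable (B j)) ->
    P (\bigcap_(j in [set: 'I_m]) (X j @^-1` B j)) =
    (\prod_(j < m) P (X j @^-1` B j))%E.

Definition lincomb (R : realType) (d N : nat)
    (phi : 'I_N -> 'rV[R]_d -> R) (a : 'I_N -> R) : 'rV[R]_d -> R :=
  fun x => \sum_(i < N) a i * phi i x.

(* Main.v *)
Require Import Defs.
From HB Require Import structures.
From mathcomp Require Import all_boot all_order all_algebra.
From mathcomp Require Import all_classical all_reals all_analysis.
From mathcomp Require Import measurable_realfun.
From mathcomp Require Import ring lra zify.
Set Implicit Arguments.
Unset Strict Implicit.
Unset Printing Implicit Defensive.
Import Order.TTheory GRing.Theory Num.Theory.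
Import numFieldNormedType.Exports.
Local Open Scope classical_set_scope.
Local Open Scope ring_scope.

(* For a fixed f in X_N the variables |f(xi_j)|^q / (H ||f||_q)^q lie in [0, 1]
   and have mean H^-q, so by Chernoff the empirical mean of |f|^q is within a
   factor 1 +- 1/4 of ||f||_q^q outside an event of probability at most
   2 exp(- m H^-q / 256).  A union bound extends this to a net of the unit ball
   of L_q with mesh 1/r, r of order 24 q, which has at most (16 r)^N points.
   The empirical L_q functional is itself a seminorm, at most H times the L_q
   norm on the sample, so the usual self-bounding argument passes from the net
   to all of X_N; the mesh 1/q is what loses only a constant factor after
   raising to the power q.  Since N log(r) and log(1/delta) are both at most
   const * delta^-2 q^2 N, the hypothesis on m suffices.

   The cardinality of the net is bounded by counting points of a fine lattice
   instead of comparing volumes.  The deterministic choice of points is obtained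
   by derandomising the union bound, so no product space is constructed. *)

(** * Nets of balls of finite-dimensional norms *)

(** Greedy selection: an element is kept exactly when nothing kept so far is near it, so a rejected
    element is covered by whatever caused its rejection. *)
Lemma exists_maximal_separated (T : eqType) (near : rel T) (A : seq T) :
  reflexive near -> symmetric near ->
  exists S : seq T, [/\ uniq S, {subset S <= A},
    {in S &, forall s s', near s s' -> s = s'} &
    {in A, forall a, exists2 s, s \in S & near a s}].
Proof.
move=> near_refl near_sym; elim: A => [|a A [S [uS SA sepS covS]]].
  by exists [::]; split.
have [/hasP [s sS nas]|/hasPn faraS] := boolP (has (near a) S).
  exists S; split=> // [x /SA|x]; first by rewrite inE orbC => ->.
  by rewrite inE => /predU1P [->|/covS//]; exists s.
exists (a :: S); split => /=.
- by rewrite uS andbT; apply/negP => /faraS; rewrite near_refl.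
- by move=> x; rewrite !inE => /predU1P [->|/SA ->]; rewrite ?eqxx ?orbT.
- move=> s s'; rewrite !inE => /predU1P [->|sS] /predU1P [->|s'S] //.
  + by move/(negP (faraS _ s'S)).
  + by rewrite near_sym => /(negP (faraS _ sS)).
  + exact: sepS.
- move=> x; rewrite inE => /predU1P [->|/covS [s sS nxs]].
    by exists a; rewrite ?inE ?eqxx.
  by exists s; rewrite // inE sS orbT.
Qed.

Lemma size_sum_count (T : Type) (K : finType) (cls : T -> K) (A : seq T) :
  size A = (\sum_k count (fun z => cls z == k) A)%N.
Proof.
elim: A => [|z A IHA] /=; first by rewrite big1.
rewrite IHA big_split /= -add1n; congr addn.
rewrite (bigD1 (cls z)) //= eqxx big1 // => k /negPf.
by rewrite eq_sym => ->.
Qed.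

Lemma finite_int_box (N B : nat) :
  exists A : seq 'rV[int]_N, forall z, (z \in A) = [forall i, `|z 0 i| <= B%:Z].
Proof.
pose F := {ffun 'I_N -> 'I_(2 * B).+1}.
exists [seq \row_i ((f i : nat)%:Z - B%:Z) | f : F <- enum {: F}] => z.
apply/mapP/forallP => [[f _ ->] i|zB].
  by rewrite mxE ler_norml; case: (f i) => k /=; lia.
exists [ffun i : 'I_N => inord (absz (z ord0 i + B%:Z))]; first by rewrite mem_enum.
apply/rowP => i; rewrite mxE ffunE; move: (zB i).
by rewrite ler_norml -[0]/ord0; move: (z ord0 i) => x xB; rewrite inordK; lia.
Qed.

Definition lattice_point (R : realType) (N : nat) (h : R) (z : 'rV[int]_N) :
  'rV[R]_N := h *: map_mx intr z.

Lemma lattice_pointD (R : realType) (N : nat) (h : R) (z w : 'rV[int]_N) :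
  lattice_point h (z + w) = lattice_point h z + lattice_point h w.
Proof. by rewrite /lattice_point map_mxD scalerDr. Qed.

Lemma lattice_pointB (R : realType) (N : nat) (h : R) (z w : 'rV[int]_N) :
  lattice_point h (z - w) = lattice_point h z - lattice_point h w.
Proof. by rewrite /lattice_point map_mxB scalerBr. Qed.

(** A seminorm: definiteness is left out because the empirical functional may vanish on nonzero
    vectors; [norm_coord_bound] assumes it separately. *)
Definition is_norm (R : realType) (V : lmodType R) (nu : V -> R) : Prop :=
  [/\ forall v, 0 <= nu v, forall v w, nu (v + w) <= nu v + nu w &
      forall t v, nu (t *: v) = `|t| * nu v].

Lemma is_normN (R : realType) (V : lmodType R) (nu : V -> R) :
  is_norm nu -> forall v, nu (- v) = nu v.
Proof. by move=> [_ _ nuZ] v; rewrite -scaleN1r nuZ normrN1 mul1r. Qed.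

Lemma is_norm_sub (R : realType) (V : lmodType R) (nu : V -> R) :
  is_norm nu -> forall v w, nu (v - w) <= nu v + nu w.
Proof. by move=> n_nu v w; rewrite -[nu w](is_normN n_nu); case: n_nu. Qed.

Lemma is_norm0 (R : realType) (V : lmodType R) (nu : V -> R) :
  is_norm nu -> nu 0 = 0.
Proof. by move=> [_ _ nuZ]; rewrite -(scale0r 0) nuZ normr0 mul0r. Qed.

Lemma is_norm_sum (R : realType) (V : lmodType R) (nu : V -> R) (I : Type)
    (s : seq I) (F : I -> V) :
  is_norm nu -> nu (\sum_(i <- s) F i) <= \sum_(i <- s) nu (F i).
Proof.
move=> n_nu; elim: s => [|i s IHs]; first by rewrite !big_nil (is_norm0 n_nu).
rewrite !big_cons; case: n_nu => _ nuD _.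
by apply: (le_trans (nuD _ _)); rewrite lerD2l.
Qed.

Lemma is_norm_le_sum_delta (R : realType) (N : nat) (nu : 'rV[R]_N -> R)
    (v : 'rV[R]_N) (b : R) :
  is_norm nu -> (forall i, `|v 0 i| <= b) ->
  nu v <= b * \sum_i nu (delta_mx 0 i).
Proof.
move=> n_nu vb; rewrite [in X in X <= _](row_sum_delta v) mulr_sumr.
apply: (le_trans (is_norm_sum _ _ n_nu)); case: n_nu => nu0 _ nuZ.
by apply: ler_sum => i _; rewrite nuZ ler_wpM2r.
Qed.

(* Two lattice points of the ball of radius 2 that are congruent modulo [k]
   differ by [k] times a lattice point of the ball of radius [4 / k], and there
   are [k ^ N] congruence classes; this replaces a volume comparison. *)
Lemma lattice_ball_size (R : realType) (N k : nat) (nu : 'rV[R]_N -> R) (h : R)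
    (A2 Ar : seq 'rV[int]_N) :
  is_norm nu -> (0 < k)%N -> uniq A2 ->
  {in A2, forall z, nu (lattice_point h z) <= 2} ->
  (forall z, nu (lattice_point h z) <= 4 / k%:R -> z \in Ar) ->
  (size A2 <= k ^ N * size Ar)%N.
Proof.
case: k => // k n_nu _ uA2 A2P ArP.
pose cls (z : 'rV[int]_N) : {ffun 'I_N -> 'I_k.+1} :=
  [ffun i => inord (absz (z ord0 i %% k.+1%:Z)%Z)].
have clsE z w : cls z = cls w -> forall i, (k.+1%:Z %| z ord0 i - w ord0 i)%Z.
  move=> /ffunP zw i; rewrite -eqz_mod_dvd; have := zw i; rewrite !ffunE.
  have modK (x : int) :
      (inord (absz (x %% k.+1%:Z)%Z) : 'I_k.+1) = absz (x %% k.+1%:Z)%Z :> nat.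
    by rewrite inordK // -ltz_nat gez0_abs ?modz_ge0 // ltz_pmod.
  move/(congr1 val) => /=; rewrite !modK => /(congr1 Posz).
  by rewrite !gez0_abs ?modz_ge0 // => ->.
rewrite (size_sum_count cls) -[X in (_ <= X ^ _ * _)%N]card_ord.
rewrite -[X in (_ <= _ ^ X * _)%N](card_ord N) -card_ffun -sum_nat_const.
apply: leq_sum => c _; rewrite -size_filter.
set F := [seq z <- A2 | cls z == c].
case EF: F => [//|z0 F']; rewrite -EF.
have FP z : z \in F -> cls z = c /\ z \in A2.
  by rewrite mem_filter => /andP [/eqP].
have [cz0 z0A] : cls z0 = c /\ z0 \in A2 by apply: FP; rewrite EF mem_head.
(* Relative to one member [z0] of the class, division by [k.+1] is exact and injective, and it lands
   in the ball of radius [4 / k.+1]. *)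
pose g (z : 'rV[int]_N) : 'rV[int]_N := \row_i ((z ord0 i - z0 ord0 i) %/ k.+1%:Z)%Z.
have gK z : z \in F -> z - z0 = k.+1%:Z *: g z.
  move=> /FP [cz _]; apply/rowP => i; rewrite !mxE mulrC divzK //.
  by apply: clsE; rewrite cz cz0.
rewrite -(size_map g); apply: uniq_leq_size.
  rewrite map_inj_in_uniq ?filter_uniq // => z w /gK zE /gK wE gzw.
  by apply: (addIr (- z0)); rewrite zE wE gzw.
move=> _ /mapP [z zF ->]; apply: ArP.
have -> : lattice_point h (g z) =
    k.+1%:R^-1 *: (lattice_point h z - lattice_point h z0).
  rewrite -lattice_pointB gK // /lattice_point; apply/rowP => i; rewrite !mxE.
  rewrite intrM; set a := (_ %/ _)%Z%:~R; rewrite [k.+1%:Z%:~R](_ : _ = k.+1%:R) //.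
  by field; rewrite (_ : 1 + k%:R = k.+1%:R) // -natr1 addrC.
have := is_norm_sub n_nu (lattice_point h z) (lattice_point h z0).
have [_ zA] := FP _ zF; have := A2P _ z0A; have := A2P _ zA.
move=> hz hz0 hs; case: n_nu => _ _ ->; rewrite ger0_norm ?invr_ge0 //.
by rewrite mulrC ler_wpM2r ?invr_ge0 //; lra.
Qed.

Lemma exists_lattice_near (R : realType) (N : nat) (h : R) (v : 'rV[R]_N) :
  0 < h -> exists z : 'rV[int]_N,
    forall i, `|(v - lattice_point h z) 0 i| <= h.
Proof.
move=> h0; exists (\row_i Num.floor (v 0 i / h)) => i; rewrite !mxE.
have hn : h != 0 by rewrite gt_eqF.
have -> : v 0 i - h * (Num.floor (v 0 i / h))%:~R =
    h * (v 0 i / h - (Num.floor (v 0 i / h))%:~R) by field.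
rewrite normrM (gtr0_norm h0) ler_piMr ?(ltW h0) //.
have /andP [] := floor_itv (v 0 i / h); rewrite intrD mulr1z => fl fu.
by rewrite ler_norml; lra.
Qed.

(** Packing on a lattice: translates of the lattice ball of radius [rho] by a [2 * rho]-separated
    subset of the ball of radius 3/2 are disjoint and lie in the ball of radius 2. By
    [lattice_ball_size] with [k = 16 * r], the latter has at most [(16 * r) ^ N] times as many
    points as the ball of radius [4 / (16 * r) = rho]. The coordinate bound makes these lattice
    balls finite. *)
Lemma norm_ball_net (R : realType) (N : nat) (nu : 'rV[R]_N -> R) (C : R)
    (r : nat) :
  is_norm nu -> (forall (v : 'rV[R]_N) i, `|v 0 i| <= C * nu v) -> (0 < r)%N ->
  exists S : seq 'rV[R]_N, (size S <= (16 * r) ^ N)%N /\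
    forall v, nu v <= 1 -> exists2 g, g \in S & nu (v - g) <= r%:R^-1.
Proof.
move=> n_nu nuC r0; have [nu_ge0 nuD nuZ] := n_nu.
have rR : 0 < r%:R :> R by rewrite ltr0n.
have r1 : 1 <= r%:R :> R by rewrite ler1n.
(* The mesh is [4 * rho]: half of it pays for rounding to the lattice, half for the distance to a
   selected point. *)
pose rho : R := (4 * r%:R)^-1.
have rhoE : r%:R^-1 = 4 * rho by rewrite /rho; field; rewrite gt_eqF.
have rho0 : 0 < rho by rewrite invr_gt0; lra.
have rho4 : 4 * rho <= 1 by rewrite -rhoE invf_le1.
pose D := \sum_i nu (delta_mx 0 i).
have D0 : 0 <= D by apply: sumr_ge0.
(* Rounding every coordinate to spacing [h] costs at most [h * D <= 2 * rho]; the [+ 1] keeps the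
   denominator positive. *)
pose h := 2 * rho / (D + 1).
have h0 : 0 < h by rewrite /h divr_gt0 //; lra.
have hD : h * D <= 2 * rho.
  rewrite /h mulrAC ler_pdivrMr; last lra.
  by apply: ler_wpM2l; lra.
have [A AE] := finite_int_box N (Num.truncn (2 * `|C| / h)).+1.
have AP z : nu (lattice_point h z) <= 2 -> z \in A.
  move=> z2; rewrite AE; apply/forallP => i.
  have : `|h * (z 0 i)%:~R| <= `|C| * 2.
    apply: le_trans (_ : C * nu (lattice_point h z) <= _).
      by have := nuC (lattice_point h z) i; rewrite !mxE.
    apply: le_trans (_ : `|C| * nu (lattice_point h z) <= _).
      by rewrite ler_wpM2r // ler_norm.
    by rewrite ler_wpM2l.
  rewrite normrM (gtr0_norm h0) mulrC -ler_pdivlMr // => zi.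
  rewrite -(ler_int R) intr_norm.
  apply: (le_trans zi); rewrite [`|C| * 2]mulrC; apply/ltW/truncnS_gt.
pose ball t := [seq z <- undup A | nu (lattice_point h z) <= t].
have ball_uniq t : uniq (ball t) by rewrite filter_uniq ?undup_uniq.
have ballP t z : t <= 2 -> (z \in ball t) = (nu (lattice_point h z) <= t).
  move=> t2; rewrite mem_filter mem_undup; apply/andb_idr => zt.
  by apply: AP; apply: le_trans t2.
pose near z w := nu (lattice_point h (z - w)) <= 2 * rho.
have near_refl : reflexive near.
  move=> z; rewrite /near lattice_pointB subrr (is_norm0 n_nu); lra.
have near_sym : symmetric near.
  by move=> z w; rewrite /near !lattice_pointB -[in LHS](is_normN n_nu) opprB.
(* Radius 3/2 leaves room on both sides: rounding a vector of the unit ball moves it by at most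
   [2 * rho <= 1/2], and adding a vector of norm [rho] stays within radius 2. *)
have [S [uS SA sepS covS]] :=
  exists_maximal_separated (ball (3 / 2)) near_refl near_sym.
exists (map (lattice_point h) S); rewrite size_map; split; last first.
  move=> v v1; have [z zv] := exists_lattice_near v h0.
  have vz : nu (v - lattice_point h z) <= 2 * rho.
    apply: le_trans hD; exact: is_norm_le_sum_delta.
  have zb : z \in ball (3 / 2).
    rewrite ballP; last lra.
    have := is_norm_sub n_nu v (v - lattice_point h z).
    rewrite subKr; lra.
  have [s sS nzs] := covS _ zb; exists (lattice_point h s); first exact: map_f.
  move: nzs; rewrite /near lattice_pointB => nzs.
  have := nuD (v - lattice_point h z) (lattice_point h z - lattice_point h s).
  by rewrite addrA subrK rhoE; lra.
have ub := @lattice_ball_size R N (16 * r) nu h (ball 2) (ball rho) n_nu.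
have {}ub : (size (ball 2%R) <= (16 * r) ^ N * size (ball rho))%N.
  apply: ub => //; first by rewrite muln_gt0.
    by move=> z; rewrite ballP.
  move=> z zr; rewrite ballP; last lra.
  apply: (le_trans zr); rewrite le_eqVlt; apply/orP; left; apply/eqP.
  by rewrite /rho natrM; field; rewrite gt_eqF.
have sb : (0 < size (ball rho))%N.
  rewrite -has_predT; apply/hasP; exists 0 => //; rewrite ballP; last lra.
  by rewrite /lattice_point map_mx0 scaler0 (is_norm0 n_nu); lra.
rewrite -(leq_pmul2r sb); apply: leq_trans ub.
rewrite -(size_allpairs (fun s u => s + u)); apply: uniq_leq_size.
  apply: allpairs_uniq => // -[s u] [s' u'].
  move=> /allpairsP [[x y] /= [sS uB [? ?]]]; subst x y.
  move=> /allpairsP [[x y] /= [s'S u'B [? ?]]] /= E; subst x y.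
  move: uB u'B; rewrite !ballP; [|lra|lra] => uB u'B.
  have ss : s = s'.
    apply: sepS => //; rewrite /near.
    (* Colliding sums make the centres differ by [u' - u], of norm at most [2 * rho], against
       separation. *)
    have -> : s - s' = u' - u.
      by apply/eqP; rewrite subr_eq addrAC eq_sym subr_eq E addrC.
    rewrite lattice_pointB.
    by have := is_norm_sub n_nu (lattice_point h u') (lattice_point h u); lra.
  by move: E; rewrite ss => /addrI ->.
move=> _ /allpairsP [[s u] /= [/SA sb' ub' ->]].
move: sb' ub'; rewrite !ballP; [|lra|lra|lra].
rewrite lattice_pointD.
by have := nuD (lattice_point h s) (lattice_point h u); lra.
Qed.

(** * From a net to the whole space *)

Lemma powRK (R : realType) (q x : R) : q != 0 -> 0 <= x ->
  (x `^ q) `^ q^-1 = x.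
Proof. by move=> q0 x0; rewrite -powRrM mulfV // powRr1. Qed.

Lemma powRVK (R : realType) (q x : R) : q != 0 -> 0 <= x ->
  (x `^ q^-1) `^ q = x.
Proof. by move=> q0 x0; rewrite -powRrM mulVf // powRr1. Qed.

(** For real exponents, pass to the logarithm: ln (1 - x) >= 1 - 1/(1 - x) >= -2x on [0, 1/2], then
    exp y >= 1 + y. *)
Lemma bernoulli_powR (R : realType) (q x : R) : 0 <= q -> 0 <= x <= 2^-1 ->
  1 - 2 * q * x <= (1 - x) `^ q.
Proof.
move=> q0 /andP [x0 x1]; have y0 : 0 < 1 - x by lra.
rewrite /powR gt_eqF //; apply: le_trans (expR_ge1Dx _).
rewrite lerD2l -[1 - x]invrK lnV ?posrE ?invr_gt0 // mulrN lerN2.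
rewrite -mulrA [2 * _]mulrCA ler_wpM2l // -[(1 - x)^-1](subrKC 1).
have y1 : 1 <= (1 - x)^-1 by rewrite invf_ge1; lra.
apply: (le_trans (le_ln1Dx _)); first lra.
have : (1 - x) * (1 - x)^-1 = 1 by rewrite mulfV ?gt_eqF.
by set y := (1 - x)^-1 in y1 *; nra.
Qed.

Lemma convex_abs_powR (R : realType) (q t a b : R) : 1 <= q -> 0 <= t <= 1 ->
  `|t * a + (1 - t) * b| `^ q <= t * `|a| `^ q + (1 - t) * `|b| `^ q.
Proof.
move=> q1 /andP [t0 t1]; have t1' : 0 <= 1 - t by lra.
apply: (@le_trans _ _ ((t * `|a| + (1 - t) * `|b|) `^ q)).
  rewrite ge0_ler_powR ?nnegrE ?(le_trans _ q1) //.
    by rewrite addr_ge0 // mulr_ge0.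
  by rewrite (le_trans (ler_normD _ _)) // 2!normrM (ger0_norm t0) (ger0_norm t1').
have := @convex_powR R q q1 (Itv01 t0 t1) `|a| `|b|.
by apply; rewrite inE /= in_itv /= normr_ge0.
Qed.

(* The unit ball of a convex [q]-homogeneous functional is convex. *)
Lemma is_norm_root (R : realType) (V : lmodType R) (Phi : V -> R) (q : R) :
  1 <= q -> (forall v, 0 <= Phi v) ->
  (forall t v, Phi (t *: v) = `|t| `^ q * Phi v) ->
  (forall t v w, 0 <= t <= 1 ->
     Phi (t *: v + (1 - t) *: w) <= t * Phi v + (1 - t) * Phi w) ->
  is_norm (fun v => Phi v `^ q^-1).
Proof.
move=> q1 Phi0 PhiZ PhiC; have q0 : 0 < q by lra.
have qn0 : q != 0 by rewrite gt_eqF.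
split=> [v|v w|t v]; first exact: powR_ge0; last first.
  by rewrite PhiZ powRM ?powR_ge0 // powRK.
(* The slack [e] makes the radii [a] and [b] positive even where [Phi] vanishes, so both vectors can
   be scaled into the unit ball. *)
apply/ler_addgt0Pr => e e0.
pose a := Phi v `^ q^-1 + e / 2; pose b := Phi w `^ q^-1 + e / 2.
have a0 : 0 < a by rewrite /a; have := powR_ge0 (Phi v) q^-1; lra.
have b0 : 0 < b by rewrite /b; have := powR_ge0 (Phi w) q^-1; lra.
have one_pow r : 1 `^ r = 1 :> R by rewrite powR1.
have unit_ball u c : 0 < c -> Phi u `^ q^-1 <= c -> Phi (c^-1 *: u) <= 1.
  move=> c0 uc; rewrite PhiZ gtr0_norm ?invr_gt0 //.
  rewrite -[Phi u](powRVK qn0 (Phi0 u)) -powRM ?powR_ge0 ?invr_ge0 ?(ltW c0) ?(ltW q0) //.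
  rewrite -[leRHS](one_pow q) ge0_ler_powR ?nnegrE ?(ltW c0) ?(ltW q0) //.
    by rewrite mulr_ge0 ?powR_ge0 ?invr_ge0 ?(ltW c0) ?(ltW q0).
  by rewrite mulrC ler_pdivrMr // mul1r.
have va : Phi (a^-1 *: v) <= 1 by apply: unit_ball; rewrite // /a; lra.
have wb : Phi (b^-1 *: w) <= 1 by apply: unit_ball; rewrite // /b; lra.
pose t := a / (a + b).
have ab0 : 0 < a + b by lra.
have t01 : 0 <= t <= 1.
  by rewrite divr_ge0 ?(ltW a0) ?(ltW ab0) //= ler_pdivrMr // mul1r; lra.
have vwE : v + w = (a + b) *: (t *: (a^-1 *: v) + (1 - t) *: (b^-1 *: w)).
  rewrite scalerDr !scalerA; congr (_ + _).
    rewrite -[LHS]scale1r; congr (_ *: _); rewrite /t; field.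
    by rewrite !gt_eqF.
  rewrite -[LHS]scale1r; congr (_ *: _); rewrite /t; field.
  by rewrite !gt_eqF.
have cvx : Phi (t *: (a^-1 *: v) + (1 - t) *: (b^-1 *: w)) <= 1.
  apply: (le_trans (PhiC _ _ _ t01)).
  by case/andP: t01 => t0 t1; nra.
have -> : Phi v `^ q^-1 + Phi w `^ q^-1 + e = a + b by rewrite /a /b; field.
rewrite vwE PhiZ powRM ?powR_ge0 // powRK // gtr0_norm //.
rewrite ler_piMr ?(ltW ab0) // -[leRHS](one_pow q^-1).
by rewrite ge0_ler_powR ?nnegrE ?invr_ge0 // (ltW q0).
Qed.

(** Let [M] be the best constant in [rho <= M * nu]. Approximating by a net point gives
    [M <= al * (1 + e) + e * M], which bounds [M] in terms of [al] alone; [K] serves to make [M]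
    finite and does not enter the result. The bound on [M] then controls the approximation error in
    the lower estimate. *)
Lemma norm_comparison_from_net (R : realType) (V : lmodType R) (nu rho : V -> R)
    (q K e : R) (S : seq V) :
  1 <= q -> is_norm nu -> is_norm rho -> (forall v, rho v <= K * nu v) ->
  0 < e -> 24 * q * e <= 1 ->
  (forall v, nu v <= 1 -> exists2 g, g \in S & nu (v - g) <= e) ->
  (forall g, g \in S ->
     3 / 4 * nu g `^ q <= rho g `^ q /\ rho g `^ q <= 5 / 4 * nu g `^ q) ->
  forall v, 2^-1 * nu v `^ q <= rho v `^ q /\ rho v `^ q <= 3 / 2 * nu v `^ q.
Proof.
move=> q1 n_nu n_rho rhoK e0 qe net Sg.
have [nu0 nuD nuZ] := n_nu; have [rho0 rhoD rhoZ] := n_rho.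
have q0 : 0 < q by lra.
have qn0 : q != 0 by rewrite gt_eqF.
have e24 : 24 * e <= 1 by nra.
have root_le x y (c : R) : 0 <= x -> 0 <= y -> 0 <= c ->
    (x `^ q <= c * y `^ q) = (x <= c `^ q^-1 * y).
  move=> x0 y0 c0; rewrite -{1}(powRVK qn0 c0) -powRM ?powR_ge0 //.
  have cy0 : 0 <= c `^ q^-1 * y by rewrite mulr_ge0 ?powR_ge0.
  by apply/idP/idP => h; [rewrite -[x](powRK qn0) // -[leRHS](powRK qn0) //|];
    rewrite ge0_ler_powR ?nnegrE ?powR_ge0 ?invr_ge0 ?(ltW q0).
have root_ge x y (c : R) : 0 <= x -> 0 <= y -> 0 <= c ->
    (c * y `^ q <= x `^ q) = (c `^ q^-1 * y <= x).
  move=> x0 y0 c0; rewrite -{1}(powRVK qn0 c0) -powRM ?powR_ge0 //.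
  have cy0 : 0 <= c `^ q^-1 * y by rewrite mulr_ge0 ?powR_ge0.
  by apply/idP/idP => h; [rewrite -[x](powRK qn0) // -[leLHS](powRK qn0) //|];
    rewrite ge0_ler_powR ?nnegrE ?powR_ge0 ?invr_ge0 ?(ltW q0).
pose al : R := (5 / 4) `^ q^-1; pose be : R := (3 / 4) `^ q^-1.
have al0 : 0 < al by apply: powR_gt0; lra.
have be0 : 0 < be by apply: powR_gt0; lra.
have rho_le g : g \in S -> rho g <= al * nu g.
  by move=> /Sg [_]; rewrite root_le //; lra.
have rho_ge g : g \in S -> be * nu g <= rho g.
  by move=> /Sg []; rewrite root_ge //; lra.
pose X := [set rho v | v in [set v | nu v <= 1]].
have X0 : X (rho 0) by exists 0 => //=; rewrite (is_norm0 n_nu).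
have Xub : ubound X `|K|.
  move=> _ [v v1 <-]; apply: (le_trans (rhoK v)).
  have := nu0 v; have := ler_norm K; have := normr_ge0 K; move: v1 => /=; nra.
have supX : has_sup X by split; [exists (rho 0)|exists `|K|].
pose M := sup X.
have MP v : nu v <= 1 -> rho v <= M.
  by move=> v1; apply: sup_upper_bound => //; exists v.
have M0 : 0 <= M by rewrite -(is_norm0 n_rho) MP // (is_norm0 n_nu).
have rhoM v : rho v <= M * nu v.
  have [v0|vn0] := eqVneq (nu v) 0.
    by have := rhoK v; rewrite v0 !mulr0.
  have vp : 0 < nu v by rewrite lt_neqAle eq_sym vn0 nu0.
  have := MP ((nu v)^-1 *: v); rewrite nuZ rhoZ gtr0_norm ?invr_gt0 //.
  rewrite mulVf // => /(_ (lexx _)).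
  by rewrite mulrC ler_pdivrMr.
have M1 : M <= al * (1 + e) + e * M.
  apply: ge_sup; first by exists (rho 0).
  move=> _ [v /= v1 <-]; have [g gS vg] := net _ v1.
  have h1 := rhoD g (v - g); rewrite subrKC in h1.
  have h2 := rho_le _ gS; have h3 := rhoM (v - g).
  have h4 : nu g <= 1 + e.
    have := is_norm_sub n_nu v (v - g); rewrite subKr; lra.
  nra.
have M2 : M * (1 - 2 * e) <= al by nra.
(* Since [24 * q * e <= 1], (1 - 2e)^q >= 1 - 4qe >= 5/6, and (5/4) / (5/6) = 3/2. *)
have M32 : M `^ q <= 3 / 2.
  have : (M * (1 - 2 * e)) `^ q <= al `^ q.
    by rewrite ge0_ler_powR ?nnegrE ?(ltW q0) ?(ltW al0) ?mulr_ge0 //; lra.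
  rewrite powRM //; last lra.
  rewrite powRVK //.
  have : 1 - 2 * q * (2 * e) <= (1 - 2 * e) `^ q.
    by apply: bernoulli_powR; [lra|apply/andP; split; lra].
  have := powR_ge0 M q; set x := M `^ q; set y := (1 - 2 * e) `^ q.
  move=> x0 hy hxy; have : 5 / 6 <= y by lra.
  nra.
(* Expressing [M] through [be] turns the error [M * e] into a relative loss of at most [2 * e] in
   the lower bound. *)
have Mbe : M <= 2 * be.
  have : M `^ q <= 3 / 4 * 2 `^ q.
    apply: (le_trans M32); have : 2 <= 2 `^ q :> R by apply: le1r_powR; lra.
    lra.
  by rewrite root_le // mulrC.
move=> v; have [v0|vn0] := eqVneq (nu v) 0.
  have := rhoK v; have := rho0 v; rewrite v0 mulr0 => h1 h2.
  have -> : rho v = 0 by apply/le_anti; rewrite h1 h2.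
  by rewrite powR0 // !mulr0.
have vp : 0 < nu v by rewrite lt_neqAle eq_sym vn0 nu0.
split; last first.
  apply: (@le_trans _ _ ((M * nu v) `^ q)).
    by rewrite ge0_ler_powR ?nnegrE ?(ltW q0) ?mulr_ge0.
  by rewrite powRM // ler_wpM2r ?powR_ge0.
(* For a normalised vector the net point has [nu g >= 1 - e], so [rho w >= be * (1 - e) - M * e]. *)
have h : be * (1 - 3 * e) * nu v <= rho v.
  pose w := (nu v)^-1 *: v.
  have w1 : nu w = 1 by rewrite nuZ gtr0_norm ?invr_gt0 // mulVf.
  have [|g gS wg] := net w; first by rewrite w1.
  have h1 := is_norm_sub n_rho w (w - g); rewrite subKr in h1.
  have h3 := nuD g (w - g); rewrite subrKC w1 in h3.
  have h4 := rho_ge _ gS; have h5 := rhoM (w - g).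
  have h6 : be * (1 - 3 * e) <= rho w by nra.
  have -> : rho v = rho w * nu v.
    by rewrite rhoZ gtr0_norm ?invr_gt0 // mulrC mulrA mulfV // mul1r.
  by rewrite ler_wpM2r.
apply: (@le_trans _ _ ((be * (1 - 3 * e) * nu v) `^ q)); last first.
  rewrite ge0_ler_powR ?nnegrE ?(ltW q0) ?mulr_ge0 ?(ltW be0) //; lra.
rewrite powRM ?mulr_ge0 ?(ltW be0) //; last lra.
rewrite ler_wpM2r ?powR_ge0 // powRM ?(ltW be0) //; last lra.
rewrite powRVK //.
(* The right side is at least 1 - 6qe >= 3/4, and (3/4)^2 = 9/16 exceeds 1/2. *)
have : 1 - 2 * q * (3 * e) <= (1 - 3 * e) `^ q.
  by apply: bernoulli_powR; [lra|apply/andP; split; lra].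
lra.
Qed.

(** * Products of independent factors *)

Lemma measure_big_setU_le (R : realType) (d : measure_display)
    (T : measurableType d) (P : {measure set T -> \bar R}) (I : Type)
    (s : seq I) (A : I -> set T) :
  (forall i, measurable (A i)) ->
  measurable (\big[setU/set0]_(i <- s) A i) /\
  (P (\big[setU/set0]_(i <- s) A i) <= \sum_(i <- s) P (A i))%E.
Proof.
move=> mA; elim: s => [|i s [IHm IH]]; first by rewrite !big_nil measure0.
rewrite !big_cons; split; first exact: measurableU.
by apply: (le_trans (measureU2 _ (mA i) IHm)); rewrite leeD2l.
Qed.

(* Markov's inequality for a product of i.i.d. factors.  Splitting the range of
   [F] into finitely many slices reduces it to finite sums, so no integral over
   the sample space is needed. *)
Lemma iid_prod_markov (R : realType) (dU dT : measure_display)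
    (U : measurableType dU) (T : measurableType dT) (mu : probability U R)
    (P : probability T R) (m : nat) (xi : 'I_m -> T -> U) (F : U -> R)
    (M C : R) :
  measurable_fun setT F -> (forall x, 0 <= F x <= M) ->
  (\int[mu]_x (F x)%:E < C%:E)%E ->
  (forall j, measurable_fun setT (xi j)) ->
  (forall j (B : set U), measurable B -> P (xi j @^-1` B) = mu B) ->
  mutually_independent P xi ->
  measurable [set t | 1 <= \prod_(j < m) F (xi j t)] /\
  (P [set t | (1 <= \prod_(j < m) F (xi j t))%R] <= (C ^+ m)%:E)%E.
Proof.
move=> mF F0M FC mxi lawxi indep.
set E := [set t | _].
have mE : measurable E.
  rewrite -[E]setTI; apply: measurable_fun_le => //.
  by apply: measurable_prod => j _; exact: measurableT_comp.
split=> //.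
have intF0 : (0 <= \int[mu]_x (F x)%:E)%E.
  by apply: integral_ge0 => x _; rewrite lee_fin; case/andP: (F0M x).
have [I0 I0E] : exists I0 : R, (\int[mu]_x (F x)%:E = I0%:E)%E.
  exists (fine (\int[mu]_x (F x)%:E)%E); rewrite fineK // ge0_fin_numE //.
  exact: lt_trans (ltry C).
move: FC; rewrite I0E lte_fin => I0C.
(* Slices of width 1/n fit into the strict gap between the integral and [C], so [F] can be rounded
   up without the mean exceeding [C]. *)
pose n := (Num.truncn (C - I0)^-1).+1.
have n0 : 0 < n%:R :> R by rewrite ltr0n.
have nC : I0 + n%:R^-1 <= C.
  have : n%:R^-1 <= C - I0.
    rewrite -[leRHS]invrK lef_pV2 ?posrE ?invr_gt0 ?subr_gt0 //.
    exact/ltW/truncnS_gt.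
  lra.
(* The successor makes room for the slice that contains the value [M] itself. *)
pose K := (Num.truncn (n%:R * M)).+1.
pose D (i : 'I_K) := F @^-1` `[i%:R / n%:R, i.+1%:R / n%:R[%classic.
pose w (i : 'I_K) : R := i.+1%:R / n%:R.
have w0 i : 0 <= w i by rewrite divr_ge0.
have mD i : measurable (D i) by rewrite -[D i]setTI; exact: mF.
pose p i : R := fine (mu (D i)).
have pE i : mu (D i) = (p i)%:E by rewrite fineK // fin_num_measure.
have p0 i : 0 <= p i by rewrite fine_ge0.
pose slice x : 'I_K := inord (Num.truncn (n%:R * F x)).
have sliceE x : slice x = Num.truncn (n%:R * F x) :> nat.
  rewrite inordK // ltnS; apply: le_truncn; rewrite ler_pM2l //.
  by case/andP: (F0M x).
have sliceP x : D (slice x) x.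
  have nF0 : 0 <= n%:R * F x by rewrite mulr_ge0 //; case/andP: (F0M x).
  rewrite /D /= in_itv /= sliceE ler_pdivrMr // ltr_pdivlMr // [F x * _]mulrC.
  exact: truncn_itv.
have sum_wp : \sum_i w i * p i <= C.
  apply: le_trans nC; rewrite -lee_fin -sumEFin.
  have -> : (I0 + n%:R^-1)%:E = (\int[mu]_x ((F x)%:E + (n%:R^-1)%:E))%E.
    rewrite ge0_integralD //; first last.
    - exact/measurable_EFinP.
    - by move=> x _; rewrite lee_fin; case/andP: (F0M x).
    rewrite I0E integral_cst //= probability_setT mule1; exact: EFinD.
  have -> : (\sum_i (w i * p i)%:E =
      \int[mu]_x (\sum_i (w i * \1_(D i) x)%:E))%E.
    rewrite ge0_integral_sum //; first last.
    - by move=> i x _; rewrite lee_fin mulr_ge0.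
    - by move=> i; apply/measurable_EFinP; exact: measurable_funM.
    apply: eq_bigr => i _; rewrite EFinM -pE.
    under eq_integral => x _ do rewrite EFinM.
    rewrite ge0_integralZl_EFin ?integral_indic ?setIT //.
    exact/measurable_EFinP.
  apply: ge0_le_integral => //.
  - by move=> x _; apply: sume_ge0 => i _; rewrite lee_fin mulr_ge0.
  - apply: emeasurable_sum => i; apply/measurable_EFinP.
    exact: measurable_funM.
  - by apply: emeasurable_funD => //; exact/measurable_EFinP.
  move=> x _; rewrite sumEFin -EFinD lee_fin (bigD1 (slice x)) //=.
  rewrite indicE mem_set ?mulr1; last exact: sliceP.
  rewrite big1 ?addr0 => [|i ix]; last first.
    rewrite indicE memNset ?mulr0 // /D /= in_itv /= => /andP [h1 h2].
    have /= := sliceP x; rewrite /D /= in_itv /= => /andP [h3 h4].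
    move/eqP: ix; apply; apply/val_inj => /=.
    have e1 := le_lt_trans h1 h4; have e2 := le_lt_trans h3 h2.
    move: e1 e2; rewrite !ltr_pM2r ?invr_gt0 // !ltr_nat !ltnS => e1 e2.
    by apply/eqP; rewrite eqn_leq e1 e2.
  have /= := sliceP x; rewrite /D /= in_itv /= => /andP [h3 h4].
  rewrite /w -natr1 mulrDl mul1r lerD2r //.
pose K_m := {ffun 'I_m -> 'I_K}.
pose cell (k : K_m) :=
  \bigcap_(j in [set: 'I_m]) (xi j @^-1` D (k j)).
have mcell k : measurable (cell k).
  apply: fin_bigcap_measurable => // j _; rewrite -[_ @^-1` _]setTI.
  exact: mxi.
have Pcell k : P (cell k) = (\prod_j p (k j))%:E.
  rewrite /cell indep // -prodEFin; apply: eq_bigr => j _.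
  by rewrite lawxi.
(* Since [w] rounds [F] up, every sample point of [E] lies in a cell whose product of weights is at
   least 1. *)
pose heavy := [seq k : K_m <- enum {: K_m} | 1 <= \prod_j w (k j)].
have [mcov Pcov] := measure_big_setU_le P heavy mcell.
apply: (@le_trans _ _ (P (\big[setU/set0]_(k <- heavy) cell k))).
  apply: le_measure; rewrite ?inE // => t tE.
  pose k : K_m := [ffun j => slice (xi j t)].
  have kh : k \in heavy.
    rewrite mem_filter mem_enum andbT; apply: (le_trans tE).
    apply: ler_prod => j _; rewrite ffunE.
    have /= := sliceP (xi j t); rewrite /D /= in_itv /= => /andP [_ /ltW h4].
    by rewrite h4 andbT; case/andP: (F0M (xi j t)).
  rewrite (big_rem k) //=; left => j _ /=; rewrite ffunE; exact: sliceP.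
apply: (le_trans Pcov).
rewrite (eq_bigr (fun k : K_m => (\prod_j p (k j))%:E)) => [|k _]; last exact: Pcell.
rewrite sumEFin lee_fin big_filter big_mkcond /= big_enum /=.
(* The Markov step: the indicator of a heavy cell is at most its product of weights. The full sum
   then factors into the m-th power of one sum. *)
apply: (@le_trans _ _ (\sum_(k : K_m) \prod_j (w (k j) * p (k j)))).
  apply: ler_sum => k _; rewrite [leRHS]big_split /=.
  have pp0 : 0 <= \prod_j p (k j) by apply: prodr_ge0.
  case: ifP => h; last by rewrite mulr_ge0 //; apply: prodr_ge0.
  by rewrite ler_peMl.
rewrite -(bigA_distr_bigA (fun j i => w i * p i)) prodr_const card_ord.
apply: lerXn2r => //; rewrite ?nnegrE //; first by apply: sumr_ge0 => i _; rewrite mulr_ge0.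
apply: le_trans sum_wp; by apply: sumr_ge0 => i _; rewrite mulr_ge0.
Qed.

(** If the weighted sum exceeded its bound everywhere on [Om], integrating would give
    [\sum b C <= \sum b J] for the true means [J < C]. This forces every weight on [s] to be zero,
    and then the strict inequality reads 0 < 0. *)
Lemma exists_le_average (R : realType) (dU : measure_display)
    (U : measurableType dU) (mu : probability U R) (Om : set U) (I : eqType)
    (s : seq I) (F : I -> U -> R) (C b : I -> R) :
  measurable Om -> mu Om = 1%E ->
  (forall i, measurable_fun setT (F i)) -> (forall i x, 0 <= F i x) ->
  (forall i, (\int[mu]_x (F i x)%:E < (C i)%:E)%E) ->
  (forall i, 0 <= b i) ->
  exists2 x, Om x & \sum_(i <- s) b i * F i x <= \sum_(i <- s) b i * C i.
Proof.
move=> mOm muOm mF F0 FC b0; apply: contrapT => noP.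
have far x : Om x -> \sum_(i <- s) b i * C i < \sum_(i <- s) b i * F i x.
  by move=> xO; rewrite ltNge; apply/negP => h; apply: noP; exists x.
have [x0 x0O] : Om !=set0.
  apply/set0P/eqP => Om0; move: muOm; rewrite Om0 measure0 => /eqP.
  by rewrite eq_sym onee_eq0.
have int0 i : (0 <= \int[mu]_x (F i x)%:E)%E.
  by apply: integral_ge0 => x _; rewrite lee_fin.
pose J i := fine (\int[mu]_x (F i x)%:E)%E.
have JE i : (\int[mu]_x (F i x)%:E = (J i)%:E)%E.
  by rewrite fineK // ge0_fin_numE //; apply: lt_trans (ltry (C i)).
have JC i : J i < C i by rewrite -lte_fin -JE.
have mG : measurable_fun setT (fun x => (\sum_(i <- s) b i * F i x)%:E).
  apply/measurable_EFinP; apply: measurable_sum => i.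
  exact: measurable_funM.
have G0 x : 0 <= \sum_(i <- s) b i * F i x.
  by apply: sumr_ge0 => i _; rewrite mulr_ge0.
have le1 : \sum_(i <- s) b i * C i <= \sum_(i <- s) b i * J i.
  rewrite -lee_fin -[leLHS]mule1 -muOm -integral_cst //.
  apply: (@le_trans _ _ (\int[mu]_x (\sum_(i <- s) b i * F i x)%:E)%E).
    apply: (@le_trans _ _ (\int[mu]_(x in Om) (\sum_(i <- s) b i * F i x)%:E)%E).
      apply: ge0_le_integral => //.
      - move=> x _; rewrite /cst lee_fin; apply: sumr_ge0 => i _.
        by rewrite mulr_ge0 // (le_trans _ (ltW (JC i))) // -lee_fin -JE.
      - exact: measurable_funS mG.
      - by move=> x /far /ltW; rewrite lee_fin.
    by apply: ge0_subset_integral => // x _; rewrite lee_fin.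
  under eq_integral => x _ do rewrite -sumEFin.
  rewrite ge0_integral_sum //; first last.
  - by move=> i x _; rewrite lee_fin mulr_ge0.
  - by move=> i; apply/measurable_EFinP; exact: measurable_funM.
  rewrite -sumEFin; apply: lee_sum => i _.
  under eq_integral => x _ do rewrite EFinM.
  rewrite ge0_integralZl_EFin ?JE //.
  - by move=> x _; rewrite lee_fin.
  - exact/measurable_EFinP.
have all0 : all (fun i => true ==> (b i * (C i - J i) == 0)) s.
  rewrite -psumr_eq0; last by move=> i _; rewrite mulr_ge0 // subr_ge0 ltW.
  rewrite eq_le sumr_ge0 ?andbT; last first.
    by move=> i _; rewrite mulr_ge0 // subr_ge0 ltW.
  under eq_bigr do rewrite mulrBr.
  by rewrite sumrB subr_le0.
have b_eq0 i : i \in s -> b i = 0.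
  move=> /(allP all0) /=; rewrite mulf_eq0 subr_eq0 (gt_eqF (JC i)) orbF.
  by move/eqP.
have := far _ x0O; rewrite !big_seq !big1 ?ltxx // => i /b_eq0 ->.
- by rewrite mul0r.
- by rewrite mul0r.
Qed.

(* The points are chosen one at a time, never letting the conditional
   expectation of the number of violated constraints increase. *)
Lemma exists_points_prod_lt1 (R : realType) (dU : measure_display)
    (U : measurableType dU) (mu : probability U R) (Om : set U) (I : eqType)
    (s : seq I) (F : I -> U -> R) (C : I -> R) (m : nat) :
  measurable Om -> mu Om = 1%E ->
  (forall i, measurable_fun setT (F i)) -> (forall i x, 0 <= F i x) ->
  (forall i, (\int[mu]_x (F i x)%:E < (C i)%:E)%E) ->
  \sum_(i <- s) C i ^+ m < 1 ->
  exists pts : 'I_m -> U, (forall j, Om (pts j)) /\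
    {in s, forall i, \prod_(j < m) F i (pts j) < 1}.
Proof.
move=> mOm muOm mF F0 FC sumC.
have C0 i : 0 <= C i.
  rewrite -lee_fin; apply: le_trans (ltW (FC i)).
  by apply: integral_ge0 => x _; rewrite lee_fin.
(* Induction needs weights: [a i] accumulates the factors of the points already chosen, while each
   point still to come is charged [C i]. *)
suff H : forall n (a : I -> R), (forall i, 0 <= a i) ->
    \sum_(i <- s) a i * C i ^+ n < 1 ->
    exists pts : 'I_n -> U, (forall j, Om (pts j)) /\
      \sum_(i <- s) a i * \prod_(j < n) F i (pts j) < 1.
  have [||pts [ptsO lt1]] := H m (fun=> 1) => //.
    by under eq_bigr do rewrite mul1r.
  exists pts; split=> // i si; apply: le_lt_trans lt1.
  under [leRHS]eq_bigr do rewrite mul1r.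
  rewrite (big_rem i) //= lerDl; apply: sumr_ge0 => k _.
  exact: prodr_ge0.
elim=> [|n IHn] a a0 lt1.
  (* With an empty list of constraints the averaging lemma merely supplies a point of [Om]. *)
  have [x xO _] := @exists_le_average _ _ _ mu Om I [::] F C a mOm muOm mF F0 FC a0.
  exists (fun=> x); split=> //; under eq_bigr do rewrite big_ord0.
  exact: lt1.
have [|x xO le_x] := @exists_le_average _ _ _ mu Om I s F C
    (fun i => a i * C i ^+ n) mOm muOm mF F0 FC.
  by move=> i; rewrite mulr_ge0 // exprn_ge0.
have [||pts [ptsO lt1']] := IHn (fun i => a i * F i x).
- by move=> i; rewrite mulr_ge0.
- apply: le_lt_trans lt1; under eq_bigr do rewrite mulrAC.
  by under [leRHS]eq_bigr do rewrite exprSr mulrA.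
exists (fun j => oapp pts x (unlift ord0 j)); split=> [j|].
  by case: unliftP => [k _|_] /=.
apply: le_lt_trans lt1'; apply: ler_sum => i _.
rewrite big_ord_recl unlift_none /= mulrA.
by under eq_bigr do rewrite liftK.
Qed.

(** * Chernoff bounds for |f|^q *)

Lemma coord_le_mx_norm (R : realType) (N : nat) (v : 'rV[R]_N) i :
  `|v 0 i| <= `|v|.
Proof.
rewrite [leRHS]/Num.norm /= mx_normrE; apply/bigmax_geP; right => /=.
by exists (0, i).
Qed.

(** A definite seminorm is Lipschitz for the sup norm, so it attains a positive minimum on the
    compact unit sphere; the inverse of that minimum is the constant. *)
Lemma norm_coord_bound (R : realType) (N : nat) (nu : 'rV[R]_N -> R) :
  is_norm nu -> (forall v, nu v = 0 -> v = 0) ->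
  exists C : R, forall (v : 'rV[R]_N) i, `|v 0 i| <= C * nu v.
Proof.
move=> n_nu nu_def; have [nu0 nuD nuZ] := n_nu.
case: N nu n_nu nu_def nu0 nuD nuZ => [|N] nu n_nu nu_def nu0 nuD nuZ.
  by exists 0 => v [].
pose D := \sum_i nu (delta_mx 0 i).
have D0 : 0 <= D by apply: sumr_ge0.
have nuLip (v w : 'rV[R]_N.+1) : `|nu v - nu w| <= D * `|v - w|.
  have h : nu (v - w) <= D * `|v - w|.
    rewrite mulrC; apply: (is_norm_le_sum_delta n_nu) => i.
    exact: coord_le_mx_norm.
  have h1 := nuD (v - w) w; rewrite subrK in h1.
  have h2 := nuD (w - v) v; rewrite subrK -[nu (w - v)](is_normN n_nu) opprB in h2.
  by rewrite ler_norml; lra.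
have cnu : continuous nu.
  move=> v; apply/(@cvgrPdist_lt _ _ _ (nbhs v) (nbhs_filter v)) => e e0.
  near=> w.
  apply: (le_lt_trans (nuLip v w)).
  apply: (@le_lt_trans _ _ ((D + 1) * `|v - w|)).
    by rewrite ler_wpM2r //; lra.
  rewrite mulrC -ltr_pdivlMr; last lra.
  near: w; apply: cvgr_dist_lt; first exact: cvg_id.
  by rewrite divr_gt0 //; lra.
pose A := [set v : 'rV[R]_N.+1 | `|v| = 1].
have cA : compact A.
  apply: bounded_closed_compact.
    exists 1; split; first exact: num_real.
    by move=> x x1 v /= ->; exact: ltW.
  apply: (@closed_comp _ _ (fun v : 'rV[R]_N.+1 => `|v|) [set 1]).
    by move=> v _; exact: norm_continuous.
  exact: closed_eq.
have normalize (v : 'rV[R]_N.+1) : v != 0 -> A (`|v|^-1 *: v).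
  by move=> v0; rewrite /A /= normrZ normfV normr_id mulVf // normr_eq0.
have A0 : A !=set0.
  exists (`|const_mx 1 : 'rV[R]_N.+1|^-1 *: const_mx 1); apply: normalize.
  by apply/eqP => /rowP /(_ 0) /eqP; rewrite !mxE oner_eq0.
have [c cA' cmin] := EVT_min_rV A0 cA (continuous_subspaceT cnu).
have c0 : 0 < nu c.
  rewrite lt_neqAle nu0 andbT eq_sym; apply/eqP => /nu_def c0.
  by move: cA'; rewrite inE /A /= c0 normr0 => /eqP; rewrite eq_sym oner_eq0.
exists (nu c)^-1 => v i; apply: (le_trans (coord_le_mx_norm v i)).
rewrite mulrC ler_pdivlMr //.
have [->|v0] := eqVneq v 0; first by rewrite normr0 mul0r.
have vp : 0 < `|v| by rewrite normr_gt0.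
have := cmin (`|v|^-1 *: v); rewrite inE => /(_ (normalize _ v0)).
rewrite nuZ normfV normr_id => h.
by rewrite mulrC -ler_pdivlMr // mulrC.
Unshelve. all: by end_near.
Qed.

(** [qpow] over an arbitrary measurable space; on [Rd] the two agree by unfolding. *)
Definition Lq_pow (R : realType) (d : measure_display) (U : measurableType d)
    (mu : {measure set U -> \bar R}) (Om : set U) (q : R) (f : U -> R) : R :=
  fine (\int[mu]_(x in Om) ((`|f x| `^ q)%:E))%E.

Lemma measurable_abs_powR (R : realType) (d : measure_display)
    (U : measurableType d) (D : set U) (q : R) (f : U -> R) :
  measurable_fun D f -> measurable_fun D (fun x => `|f x| `^ q).
Proof.
move=> mf.
apply: (measurableT_comp (measurable_powR q)).
exact: measurableT_comp.
Qed.

Lemma Lq_powE (R : realType) (d : measure_display) (U : measurableType d)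
    (mu : probability U R) (Om : set U) (q : R) (f : U -> R) (B : R) :
  measurable Om -> measurable_fun Om f -> 0 <= q ->
  (forall x, Om x -> `|f x| <= B) ->
  (\int[mu]_(x in Om) ((`|f x| `^ q)%:E) = (Lq_pow mu Om q f)%:E)%E.
Proof.
move=> mOm mf q0 fB; rewrite fineK // ge0_fin_numE; last first.
  by apply: integral_ge0 => x _; rewrite lee_fin powR_ge0.
apply: (@le_lt_trans _ _ (\int[mu]_(x in Om) cst (`|B| `^ q)%:E x)%E).
  apply: ge0_le_integral => //.
  - by apply/measurable_EFinP; exact: measurable_abs_powR.
  move=> x Omx; rewrite lee_fin ge0_ler_powR ?nnegrE //.
  by rewrite (le_trans (fB x Omx)) ?ler_norm.
rewrite integral_cst // (le_lt_trans _ (ltry (`|B| `^ q * 1))) // EFinM.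
by rewrite lee_wpmul2l ?lee_fin ?powR_ge0 // probability_le1.
Qed.

Lemma Lq_pow_ge0 (R : realType) (d : measure_display) (U : measurableType d)
    (mu : {measure set U -> \bar R}) (Om : set U) (q : R) (f : U -> R) :
  0 <= Lq_pow mu Om q f.
Proof.
by apply: fine_ge0; apply: integral_ge0 => x _; rewrite lee_fin powR_ge0.
Qed.

(** Functions are indexed linearly by coefficient vectors, so that seminorms of functions become
    seminorms on ['rV[R]_N], where the lattice lives. *)
Definition is_linear_family (R : realType) (V : lmodType R) (U : Type)
    (L : V -> U -> R) : Prop :=
  (forall v w x, L (v + w) x = L v x + L w x) /\
  (forall t v x, L (t *: v) x = t * L v x).

(** Minkowski's inequality by way of [is_norm_root]: the convexity of |.|^q is integrated pointwise.
    The bound [B] keeps the integrals finite, so that [fine] loses nothing. *)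
Lemma is_norm_Lq (R : realType) (V : lmodType R) (d : measure_display)
    (U : measurableType d) (mu : probability U R) (Om : set U) (q : R)
    (L : V -> U -> R) (B : V -> R) :
  measurable Om -> is_linear_family L -> (forall v, measurable_fun Om (L v)) ->
  1 <= q -> (forall v x, Om x -> `|L v x| <= B v) ->
  is_norm (fun v => Lq_pow mu Om q (L v) `^ q^-1).
Proof.
move=> mOm [LD LZ] mL q1 LB; have q0 : 0 <= q by lra.
have PE v := Lq_powE mu mOm (mL v) q0 (LB v).
have m_pow v : measurable_fun Om (fun x => (`|L v x| `^ q)%:E).
  by apply/measurable_EFinP; exact: measurable_abs_powR.
have m_scale (t : R) v : measurable_fun Om (fun x => (t * `|L v x| `^ q)%:E).
  apply/measurable_EFinP; apply: measurable_funM => //.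
  exact: measurable_abs_powR.
have mZ (t : R) v : 0 <= t ->
    (\int[mu]_(x in Om) (t * `|L v x| `^ q)%:E =
      (t * Lq_pow mu Om q (L v))%:E)%E.
  move=> t0; under eq_integral => x _ do rewrite EFinM.
  by rewrite ge0_integralZl_EFin // PE.
apply: is_norm_root => //.
- by move=> v; exact: Lq_pow_ge0.
- move=> t v; apply: EFin_inj; rewrite -PE -mZ ?powR_ge0 //.
  by apply: eq_integral => x _; rewrite LZ normrM powRM.
move=> t v w /andP [t0 t1]; have t1' : 0 <= 1 - t by lra.
rewrite -lee_fin -PE EFinD -!mZ //.
rewrite -ge0_integralD //.
- apply: ge0_le_integral => //; first exact: emeasurable_funD.
  move=> x _; rewrite -EFinD lee_fin LD !LZ.
  by apply: convex_abs_powR; rewrite // t0.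
- by move=> x _; rewrite lee_fin mulr_ge0 ?powR_ge0.
- by move=> x _; rewrite lee_fin mulr_ge0 ?powR_ge0.
Qed.

Lemma is_norm_empirical (R : realType) (V : lmodType R) (U : Type) (q : R)
    (L : V -> U -> R) (m : nat) (y : 'I_m -> U) :
  is_linear_family L -> 1 <= q ->
  is_norm (fun v => (m%:R^-1 * \sum_(j < m) `|L v (y j)| `^ q) `^ q^-1).
Proof.
move=> [LD LZ] q1; apply: is_norm_root => //.
- move=> v; rewrite mulr_ge0 ?invr_ge0 //; apply: sumr_ge0 => j _.
  exact: powR_ge0.
- move=> t v; rewrite [RHS]mulrCA; congr (_ * _); rewrite mulr_sumr.
  apply: eq_bigr => j _; by rewrite LZ normrM powRM.
move=> t v w t01; rewrite [t * _]mulrCA [(1 - t) * _]mulrCA -mulrDr.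
rewrite ler_wpM2l ?invr_ge0 // !mulr_sumr -big_split /=.
by apply: ler_sum => j _; rewrite LD !LZ convex_abs_powR.
Qed.

(** From exp (-x) >= 1 - x follows exp x <= 1/(1 - x), and (1 + x + 2x^2)(1 - x) - 1 = x^2 (1 - 2x)
    >= 0. *)
Lemma expR_le_quadratic (R : realType) (x : R) : x <= 2^-1 ->
  expR x <= 1 + x + 2 * x ^+ 2.
Proof.
move=> x1; have h := expR_ge1Dx (- x).
have h2 : expR x * expR (- x) = 1 by exact: expRxMexpNx_1.
have h3 : expR x * (1 - x) <= 1 by rewrite -[leRHS]h2 ler_wpM2l ?expR_ge0.
have h4 : 0 < 1 - x by lra.
rewrite -(ler_pM2r h4); apply: (le_trans h3); rewrite expr2.
have : 0 <= x * x * (1 - 2 * x).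
  by rewrite mulr_ge0 //; [rewrite -expr2 sqr_ge0|lra].
lra.
Qed.

(* Chernoff factor; [s = 1] and [s = -1] give the upper and the lower tail. *)
Definition tilt (R : realType) (U : Type) (Y : U -> R) (p s : R) (x : U) : R :=
  expR (16^-1 * (s * (Y x - p) - p / 4)).

Lemma measurable_tilt (R : realType) (d : measure_display)
    (U : measurableType d) (Y : U -> R) (p s : R) :
  measurable_fun setT Y -> measurable_fun setT (tilt Y p s).
Proof.
move=> mY; apply: measurableT_comp => //.
apply: measurable_funM => //; apply: measurable_funB => //.
by apply: measurable_funM => //; exact: measurable_funB.
Qed.

(** As Y^2 <= Y and s^2 = 1, the quadratic bound on the exponential is at most the affine
    [1 + k * Y], whose mean is at most exp (kp). The terms in [s] cancel, and the exponent left is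
    -p/64 + p/128 = -p/128 < -p/256. *)
Lemma integral_tilt_lt (R : realType) (d : measure_display)
    (U : measurableType d) (mu : probability U R) (Y : U -> R) (p s : R) :
  measurable_fun setT Y -> (forall x, 0 <= Y x <= 1) ->
  (\int[mu]_x (Y x)%:E = p%:E)%E -> 0 < p -> s ^+ 2 = 1 ->
  (\int[mu]_x (tilt Y p s x)%:E < (expR (- p / 256))%:E)%E.
Proof.
move=> mY Y01 Yp p0 s1.
have s2 : s * s = 1 by rewrite -expr2.
have /andP [sN1 sP1] : -1 <= s <= 1 by apply/andP; split; nra.
pose k : R := 16^-1 * s + 2 * 16^-1 * 16^-1.
pose c0 : R := expR (16^-1 * (- (s * p) - p / 4)).
have iY : mu.-integrable setT (EFin \o Y).
  apply/integrableP; split; first exact/measurable_EFinP.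
  under eq_integral => x _.
    rewrite /= ger0_norm; last by case/andP: (Y01 x).
    over.
  by rewrite Yp ltry.
have i1 : mu.-integrable setT (EFin \o cst (1 : R)).
  exact: finite_measure_integrable_cst.
have cst1 : (\int[mu]_x (EFin \o cst (1%R : R)) x = 1)%E.
  by have := integral_cst mu measurableT 1%:E; rewrite /= probability_setT mule1.
have int1 : (\int[mu]_x (1%:E + k%:E * (EFin \o Y) x) = (1 + k * p)%:E)%E.
  rewrite (@integralD _ _ _ mu setT measurableT (EFin \o cst (1 : R))) //.
    by rewrite integralZl // Yp cst1 -EFinM -EFinD.
  exact: integrableZl.
have tilt_le x : tilt Y p s x <= c0 * (1 + k * Y x).
  have /andP [y0 y1] := Y01 x.
  have -> : tilt Y p s x = c0 * expR (16^-1 * s * Y x).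
    by rewrite /tilt /c0 -expRD; congr expR; field.
  rewrite ler_wpM2l ?expR_ge0 //.
  apply: (le_trans (expR_le_quadratic _)); first by nra.
  rewrite /k expr2.
  have -> : 16^-1 * s * Y x * (16^-1 * s * Y x) =
    16^-1 * 16^-1 * (Y x * Y x) * (s * s) by ring.
  rewrite s2; nra.
apply: (@le_lt_trans _ _ (\int[mu]_x (c0%:E * (1%:E + k%:E * (EFin \o Y) x)))%E).
  apply: ge0_le_integral => //.
  - by move=> x _; rewrite lee_fin expR_ge0.
  - by apply/measurable_EFinP; exact: measurable_tilt.
  - apply/measurable_EFinP.
    apply: measurable_funM => //; apply: measurable_funD => //.
    exact: measurable_funM.
  - by move=> x _; exact: (tilt_le x).
rewrite integralZl //; last first.
  by apply: integrableD => //; exact: integrableZl.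
rewrite int1 -EFinM lte_fin.
apply: (@le_lt_trans _ _ (c0 * expR (k * p))).
  by rewrite ler_wpM2l ?expR_ge0 // expR_ge1Dx.
rewrite /c0 -expRD ltr_expR /k; lra.
Qed.

Lemma tilt_prod_lt1 (R : realType) (U : Type) (Y : U -> R) (p s : R) (m : nat)
    (y : 'I_m -> U) :
  \prod_(j < m) tilt Y p s (y j) < 1 ->
  s * (\sum_(j < m) Y (y j) - m%:R * p) < m%:R * (p / 4).
Proof.
rewrite /tilt -expR_sum expR_lt1 -mulr_sumr pmulr_rlt0 ?invr_gt0 //.
rewrite sumrB sumr_const card_ord -mulr_sumr sumrB sumr_const card_ord.
rewrite -[(p / 4) *+ m]mulr_natl -[p *+ m]mulr_natl; lra.
Qed.

(** Normalised to take values in [0, 1] with mean H^-q, and extended by zero outside [Om] so that it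
    is measurable on the whole space. *)
Definition Lq_ratio (R : realType) (d : measure_display) (U : measurableType d)
    (mu : {measure set U -> \bar R}) (Om : set U) (q H : R) (f : U -> R)
    (x : U) : R :=
  ((fun z => `|f z| `^ q) \_ Om) x / (H `^ q * Lq_pow mu Om q f).

Lemma Lq_ratio_props (R : realType) (d : measure_display)
    (U : measurableType d) (mu : probability U R) (Om : set U) (q H : R)
    (f : U -> R) :
  measurable Om -> measurable_fun Om f -> 0 < q -> 0 < H ->
  (forall x, Om x -> `|f x| <= H * Lq_pow mu Om q f `^ q^-1) ->
  Lq_pow mu Om q f != 0 ->
  [/\ measurable_fun setT (Lq_ratio mu Om q H f),
      forall x, 0 <= Lq_ratio mu Om q H f x <= 1 &
      (\int[mu]_x (Lq_ratio mu Om q H f x)%:E = ((H `^ q)^-1)%:E)%E].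
Proof.
move=> mOm mf q0 H0 fH; set Q := Lq_pow _ _ _ _ => Qn0.
have Q0 : 0 <= Q by exact: Lq_pow_ge0.
have Qp : 0 < Q by rewrite lt_neqAle eq_sym Qn0.
have Hq : 0 < H `^ q by exact: powR_gt0.
have mpow : measurable_fun setT ((fun z => `|f z| `^ q) \_ Om).
  by apply/(measurable_restrictT _ mOm).1; exact: measurable_abs_powR.
have pow0 x : 0 <= ((fun z => `|f z| `^ q) \_ Om) x.
  by rewrite /patch; case: ifP => // _; exact: powR_ge0.
split.
- by apply: measurable_funM.
- move=> x; rewrite /Lq_ratio -/Q divr_ge0 ?pow0 ?mulr_ge0 ?(ltW Hq) //=.
  rewrite ler_pdivrMr ?mulr_gt0 // mul1r /patch; case: ifPn => [xO|_].
    have xO' : Om x by move: xO; rewrite inE.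
    rewrite -[Q](powRVK (lt0r_neq0 q0) Q0) -powRM ?powR_ge0 ?(ltW H0) //.
    rewrite ge0_ler_powR ?nnegrE ?(ltW q0) ?mulr_ge0 ?powR_ge0 ?(ltW H0) //.
    exact: fH.
  by rewrite mulr_ge0 // ltW.
rewrite /Lq_ratio -/Q.
transitivity (((H `^ q * Q)^-1)%:E * \int[mu]_x (((fun z => `|f z| `^ q) \_ Om) x)%:E)%E.
  rewrite -ge0_integralZl_EFin //.
  - by apply: eq_integral => x _; rewrite -EFinM mulrC.
  - by move=> x _; rewrite lee_fin.
  - exact/measurable_EFinP.
  - by rewrite invr_ge0 mulr_ge0 // ltW.
have -> : (\int[mu]_x (((fun z => `|f z| `^ q) \_ Om) x)%:E = Q%:E)%E.
  rewrite -(Lq_powE mu mOm mf (ltW q0) fH) [RHS]integral_mkcond.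
  by apply: eq_integral => x _; rewrite /patch; case: ifP.
by rewrite -EFinM invfM -mulrA mulVf ?mulr1.
Qed.

(* The two one-sided Chernoff factors of [f]; zero when [f] vanishes a.e., since
   then [Lq_ratio] divides by zero and there is nothing to test. *)
Definition tail_test (R : realType) (d : measure_display)
    (U : measurableType d) (mu : {measure set U -> \bar R}) (Om : set U)
    (q H : R) (f : U -> R) (b : bool) (x : U) : R :=
  if Lq_pow mu Om q f == 0 then 0
  else tilt (Lq_ratio mu Om q H f) (H `^ q)^-1 ((-1) ^+ b) x.

(** The uniform upper bound lets [iid_prod_markov] cut the range into finitely many slices. *)
Lemma tail_test_props (R : realType) (d : measure_display)
    (U : measurableType d) (mu : probability U R) (Om : set U) (q H : R)
    (f : U -> R) (b : bool) :
  measurable Om -> measurable_fun Om f -> 0 < q -> 0 < H ->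
  (forall x, Om x -> `|f x| <= H * Lq_pow mu Om q f `^ q^-1) ->
  [/\ measurable_fun setT (tail_test mu Om q H f b),
      forall x, 0 <= tail_test mu Om q H f b x <= expR (1 + (H `^ q)^-1) &
      (\int[mu]_x (tail_test mu Om q H f b x)%:E <
        (expR (- (H `^ q)^-1 / 256))%:E)%E].
Proof.
move=> mOm mf q0 H0 fH; rewrite /tail_test.
have [Q0|Qn0] := eqVneq (Lq_pow mu Om q f) 0.
  split=> //; first by move=> x; rewrite lexx expR_ge0.
  by rewrite integral0 lte_fin expR_gt0.
have [mY Y01 intY] := Lq_ratio_props mOm mf q0 H0 fH Qn0.
have p0 : 0 < (H `^ q)^-1 by rewrite invr_gt0 powR_gt0.
split; first exact: measurable_tilt.
  move=> x; rewrite expR_ge0 ler_expR.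
  have /andP [y0 y1] := Y01 x.
  by case: b; rewrite ?expr1 ?expr0; lra.
by apply: integral_tilt_lt => //; rewrite sqrr_sign.
Qed.

Lemma empirical_band (R : realType) (d : measure_display)
    (U : measurableType d) (mu : probability U R) (Om : set U) (q H : R)
    (f : U -> R) (m : nat) (y : 'I_m -> U) :
  0 < q -> 0 < H -> (0 < m)%N ->
  (forall x, Om x -> `|f x| <= H * Lq_pow mu Om q f `^ q^-1) ->
  (forall j, Om (y j)) ->
  (forall b, \prod_(j < m) tail_test mu Om q H f b (y j) < 1) ->
  3 / 4 * Lq_pow mu Om q f <= m%:R^-1 * \sum_(j < m) `|f (y j)| `^ q /\
  m%:R^-1 * \sum_(j < m) `|f (y j)| `^ q <= 5 / 4 * Lq_pow mu Om q f.
Proof.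
move=> q0 H0 m0 fH yO; rewrite /tail_test.
have [Q0|Qn0] := eqVneq (Lq_pow mu Om q f) 0.
  (* When the L_q norm vanishes, the sup bound forces f = 0 at every sample point. *)
  move=> _; rewrite Q0 !mulr0 big1 ?mulr0 // => j _.
  have := fH _ (yO j); rewrite Q0 powR0 ?invr_eq0 ?gt_eqF // mulr0.
  by rewrite normr_le0 => /eqP ->; rewrite normr0 powR0 // gt_eqF.
set Q := Lq_pow mu Om q f in Qn0 * => test1.
have Qp : 0 < Q by rewrite lt_neqAle eq_sym Qn0 Lq_pow_ge0.
have Hq : 0 < H `^ q by exact: powR_gt0.
have mR : 0 < m%:R :> R by rewrite ltr0n.
have sumE : \sum_(j < m) Lq_ratio mu Om q H f (y j) =
    (\sum_(j < m) `|f (y j)| `^ q) / (H `^ q * Q).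
  rewrite mulr_suml; apply: eq_bigr => j _; rewrite /Lq_ratio /patch.
  by rewrite mem_set.
set W := \sum_(j < m) `|f (y j)| `^ q in sumE *.
have := tilt_prod_lt1 (test1 false); have := tilt_prod_lt1 (test1 true).
rewrite sumE expr1 expr0 mul1r mulN1r.
set p := (H `^ q)^-1; have p0 : 0 < p by rewrite invr_gt0.
have -> : W / (H `^ q * Q) = p * (W / Q).
  by rewrite /p; field; rewrite Qn0 gt_eqF.
move=> lo hi.
have {}lo : 3 / 4 * m%:R <= W / Q.
  by rewrite -(ler_pM2l p0); lra.
have {}hi : W / Q <= 5 / 4 * m%:R.
  by rewrite -(ler_pM2l p0); lra.
rewrite ler_pdivlMr // in lo; rewrite ler_pdivrMr // in hi.
by rewrite ler_pdivlMl // ler_pdivrMl //; split; lra.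
Qed.

(** The net has at most (400 q)^N <= exp (400 q N) points, and 2 <= delta exp (2/delta) handles the
    two tails. With D = delta^-2 q^2 N, both q N and 1/delta are at most [D], so m/(256 h) >= 402 D
    covers 400 q N + 2/delta. *)
Lemma net_failure_bound (R : realType) (N r m s : nat) (q h delta : R) :
  (0 < N)%N -> 2 <= q -> 0 < h -> 0 < delta < 1 ->
  r%:R <= 25 * q -> (s <= (16 * r) ^ N)%N ->
  256 * 402 * delta ^- 2 * q ^+ 2 * h * N%:R <= m%:R ->
  (s * 2)%:R * expR (- h^-1 / 256) ^+ m <= delta.
Proof.
move=> N0 q2 h0 /andP [d0 d1] rq sr hm.
have N1 : 1 <= N%:R :> R by rewrite ler1n.
have sE : s%:R <= expR (400 * q * N%:R) :> R.
  apply: (@le_trans _ _ (((16 * r) ^ N)%N%:R)); first by rewrite ler_nat.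
  rewrite natrX expRM_natr lerXn2r ?nnegrE ?expR_ge0 //.
  apply: le_trans (expR_ge1Dx _); rewrite natrM; lra.
have dE : 2 <= delta * expR (2 / delta).
  rewrite -ler_pdivrMl // mulrC; apply: le_trans (expR_ge1Dx _); lra.
rewrite -expRM_natr natrM.
pose D := delta ^- 2 * q ^+ 2 * N%:R.
have hD : 256 * 402 * D <= m%:R / h.
  by rewrite ler_pdivlMr // /D; apply: le_trans hm; lra.
have di1 : 1 <= delta^-1 by rewrite invf_ge1 // ltW.
have D1 : delta^-1 <= D.
  rewrite /D -exprVn !expr2.
  have : delta^-1 <= delta^-1 * delta^-1 by rewrite ler_peMr //; lra.
  have : 1 <= q * q by nra.
  move=> a1 a2; apply: (@le_trans _ _ (delta^-1 * delta^-1 * (q * q))).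
    by rewrite (le_trans a2) // ler_peMr // mulr_ge0 //; lra.
  by rewrite ler_peMr // !mulr_ge0 //; lra.
have D2 : q * N%:R <= D.
  rewrite /D ler_wpM2r // -exprVn.
  have : 1 <= delta^-1 ^+ 2 by rewrite exprn_ege1.
  move=> a1; apply: (@le_trans _ _ (q ^+ 2)); first by rewrite expr2; nra.
  by rewrite ler_peMl // sqr_ge0.
apply: (@le_trans _ _ (expR (400 * q * N%:R) * (delta * expR (2 / delta)) *
    expR (- h^-1 / 256 * m%:R))).
  by rewrite ler_wpM2r ?expR_ge0 // ler_pM.
rewrite mulrCA -[X in X <= _]mulrA -!expRD ler_piMr ?(ltW d0) // expR_le1.
lra.
Qed.

(** The deterministic core shared by the random and the existential claims: finitely many tests
    whose success at the sample implies the band for every vector. *)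
Lemma exists_sampling_tests (R : realType) (d : measure_display)
    (U : measurableType d) (mu : probability U R) (Om : set U) (N m : nat)
    (q H delta : R) (L : 'rV[R]_N -> U -> R) :
  measurable Om -> mu Om = 1%E -> is_linear_family L ->
  (forall v, measurable_fun Om (L v)) ->
  (forall v, (forall x, Om x -> L v x = 0) -> v = 0) ->
  (0 < N)%N -> 2 <= q -> 0 < H ->
  (forall v x, Om x -> `|L v x| <= H * Lq_pow mu Om q (L v) `^ q^-1) ->
  0 < delta < 1 ->
  256 * 402 * delta ^- 2 * q ^+ 2 * H `^ q * N%:R <= m%:R ->
  exists S : seq 'rV[R]_N,
    (size S * 2)%:R * expR (- (H `^ q)^-1 / 256) ^+ m <= delta /\
    forall y : 'I_m -> U, (forall j, Om (y j)) ->
      (forall g b, g \in S ->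
         \prod_(j < m) tail_test mu Om q H (L g) b (y j) < 1) ->
      forall v,
        2^-1 * Lq_pow mu Om q (L v) <= m%:R^-1 * \sum_(j < m) `|L v (y j)| `^ q /\
        m%:R^-1 * \sum_(j < m) `|L v (y j)| `^ q <= 3 / 2 * Lq_pow mu Om q (L v).
Proof.
move=> mOm muOm linL mL Ldef N0 q2 H0 LH delta01 hm.
have q0 : 0 < q by lra.
have q1 : 1 <= q by lra.
have qn0 : q != 0 by rewrite gt_eqF.
have /andP [d0 d1] := delta01.
have Hq : 0 < H `^ q by exact: powR_gt0.
have m0 : (0 < m)%N.
  rewrite -(ltr0n R); apply: lt_le_trans hm.
  by rewrite !mulr_gt0 ?invr_gt0 ?exprn_gt0 // ltr0n.
have n_nu := is_norm_Lq mu mOm linL mL q1 LH.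
set nu := (fun v => _) in n_nu.
have nu_def v : nu v = 0 -> v = 0.
  move=> v0; apply: Ldef => x xO; have := LH v x xO.
  by rewrite -/(nu v) v0 mulr0 normr_le0 => /eqP.
have [C nuC] := norm_coord_bound n_nu nu_def.
(* The mesh 1/r must satisfy 24 q / r <= 1; rounding up keeps r <= 24 q + 1 <= 25 q. *)
pose r := (Num.truncn (24 * q)).+1.
have r_gt : 24 * q <= r%:R by apply/ltW/truncnS_gt.
have r_le : r%:R <= 25 * q.
  have h1 : (Num.truncn (24 * q))%:R <= 24 * q by rewrite truncn_le; lra.
  by rewrite /r mulrS; lra.
have [S [sizeS net]] := norm_ball_net n_nu nuC (ltn0Sn _ : (0 < r)%N).
exists S; split; first exact: net_failure_bound sizeS hm.
move=> y yO tests.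
have n_rho := is_norm_empirical y linL q1.
set rho := (fun v => _) in n_rho.
have nuq v : nu v `^ q = Lq_pow mu Om q (L v) by rewrite powRVK // Lq_pow_ge0.
have rho_ge0 v : 0 <= m%:R^-1 * \sum_(j < m) `|L v (y j)| `^ q.
  by rewrite mulr_ge0 ?invr_ge0 //; apply: sumr_ge0 => j _; exact: powR_ge0.
have rhoq v : rho v `^ q = m%:R^-1 * \sum_(j < m) `|L v (y j)| `^ q.
  by rewrite powRVK.
have nu_ge0 v : 0 <= nu v by exact: powR_ge0.
have rhoH v : rho v <= H * nu v.
  rewrite -[leRHS](powRK qn0); last by rewrite mulr_ge0 // ltW.
  rewrite ge0_ler_powR ?nnegrE ?invr_ge0 ?powR_ge0 ?(ltW q0) //.
  rewrite ler_pdivrMl ?ltr0n //.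
  apply: (@le_trans _ _ (\sum_(j < m) (H * nu v) `^ q)).
    apply: ler_sum => j _; rewrite ge0_ler_powR ?nnegrE ?(ltW q0) //.
      by rewrite mulr_ge0 // ltW.
    exact: LH.
  by rewrite sumr_const card_ord mulr_natl.
have rR : 0 < r%:R :> R by rewrite ltr0n.
move=> v; rewrite -nuq -rhoq.
apply: (norm_comparison_from_net q1 n_nu n_rho rhoH _ _ net).
- by rewrite invr_gt0.
- by rewrite ler_pdivrMr // mul1r.
- move=> g gS; rewrite nuq rhoq.
  by apply: (empirical_band q0 H0 m0 (LH g) yO) => b; exact: tests.
Qed.

(** * Sampling in R^d *)

(** A union bound over the tests; the event that some point falls outside [Om] is null and is
    removed as well. *)
Lemma iid_all_prod_lt1 (R : realType) (dU dT : measure_display)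
    (U : measurableType dU) (T : measurableType dT) (mu : probability U R)
    (P : probability T R) (m : nat) (xi : 'I_m -> T -> U) (Om : set U)
    (I : eqType) (s : seq I) (F : I -> U -> R) (M C : R) :
  measurable Om -> mu Om = 1%E ->
  (forall i, measurable_fun setT (F i)) -> (forall i x, 0 <= F i x <= M) ->
  (forall i, (\int[mu]_x (F i x)%:E < C%:E)%E) ->
  (forall j, measurable_fun setT (xi j)) ->
  (forall j (B : set U), measurable B -> P (xi j @^-1` B) = mu B) ->
  mutually_independent P xi ->
  exists A : set T,
    [/\ measurable A, ((1 - (size s)%:R * C ^+ m)%:E <= P A)%E &
        forall t, A t -> (forall j, Om (xi j t)) /\
          {in s, forall i, \prod_(j < m) F i (xi j t) < 1}].
Proof.
move=> mOm muOm mF F0M FC mxi lawxi indep.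
pose E i := [set t | 1 <= \prod_(j < m) F i (xi j t)].
have EP i := iid_prod_markov (mF i) (F0M i) (FC i) mxi lawxi indep.
have [mB1 PB1] := measure_big_setU_le P s (fun i => (EP i).1).
pose O j := xi j @^-1` (~` Om).
have mO j : measurable (O j).
  by rewrite -(setTI (O j)); apply: mxi => //; exact: measurableC.
have [mB2 PB2] := measure_big_setU_le P (enum 'I_m) mO.
set B1 := \big[setU/set0]_(i <- s) _ in mB1 PB1.
set B2 := \big[setU/set0]_(j <- _) _ in mB2 PB2.
have PO j : P (O j) = 0%E.
  rewrite lawxi; last exact: measurableC.
  have := probability_setC mu mOm.
  by rewrite muOm subee.
have PB : (P (B1 `|` B2) <= ((size s)%:R * C ^+ m)%:E)%E.
  apply: (le_trans (measureU2 _ mB1 mB2)).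
  rewrite -[leRHS]adde0; apply: leeD; last first.
    apply: (le_trans PB2); rewrite big1 // => j _; exact: PO.
  apply: (le_trans PB1).
  apply: (@le_trans _ _ (\sum_(i <- s) (C ^+ m)%:E)%E).
    by apply: lee_sum => i _; exact: (EP i).2.
  by rewrite sumEFin big_const_seq count_predT iter_addr_0 mulr_natl.
exists (~` (B1 `|` B2)); split.
- by apply: measurableC; exact: measurableU.
- rewrite probability_setC; last exact: measurableU.
  by rewrite EFinB; apply: leeB.
move=> t /not_orP [tB1 tB2]; split=> [j|i si].
  apply: contrapT => tO; apply: tB2; rewrite /B2 (big_rem j) ?mem_enum //=.
  by left.
rewrite ltNge; apply/negP => tE; apply: tB1.
by rewrite /B1 (big_rem i) //=; left.
Qed.

Lemma continuous_measurable_Rd (R : realType) (d : nat) (Om : set 'rV[R]_d)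
    (f : 'rV[R]_d -> R) :
  measurable (Om : set (Rd R d)) -> {within Om, continuous f} ->
  measurable_fun (Om : set (Rd R d)) (f : Rd R d -> R).
Proof.
move=> mOm /continuousP cf; apply: (measurability _ (RGenOpens.measurableE R)).
move=> _ [_ [a [b ->] <-]].
have open_preimage (B : set R) : open B ->
    measurable ((Om : set (Rd R d)) `&` f @^-1` B).
  move=> /cf /open_subspaceP [V oV VE].
  rewrite setIC -VE; apply: measurableI => //.
  exact: sub_sigma_algebra.
by apply: open_preimage; exact: interval_open.
Qed.

Lemma compact_measurable_Rd (R : realType) (d : nat) (Om : set 'rV[R]_d) :
  compact Om -> measurable (Om : set (Rd R d)).
Proof.
move=> cOm; rewrite -[Om]setCK; apply: measurableC.
apply: sub_sigma_algebra; rewrite openC; apply: compact_closed => //.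
Qed.

Lemma lincomb_linear (R : realType) (d N : nat) (phi : 'I_N -> 'rV[R]_d -> R) :
  is_linear_family (fun v : 'rV[R]_N => lincomb phi (v ord0)).
Proof.
split=> [v w x|t v x]; rewrite /lincomb.
  by rewrite -big_split; apply: eq_bigr => i _; rewrite mxE mulrDl.
by rewrite mulr_sumr; apply: eq_bigr => i _; rewrite mxE mulrA.
Qed.

Unset Implicit Arguments.

Theorem theorem4p2 (R : realType) :
  exists c : R, 0 < c /\
  forall (d : nat) (Omega : set 'rV[R]_d) (mu : probability (Rd R d) R)
         (N : nat) (phi : 'I_N -> 'rV[R]_d -> R) (q H delta : R),
    compact Omega ->
    mu (Omega : set (Rd R d)) = 1%E ->
    (* X_N = span of phi, an N-dimensional subspace of C(Omega) *)
    (forall i, {within Omega, continuous (phi i)}) ->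
    (forall a : 'I_N -> R,
        (forall x, Omega x -> lincomb phi a x = 0) -> forall i, a i = 0) ->
    2 <= q -> 0 < H ->
    (* ||f||_oo <= H ||f||_q for all f in X_N *)
    (forall (a : 'I_N -> R) x, Omega x ->
        `|lincomb phi a x| <= H * qnorm mu Omega q (lincomb phi a)) ->
    0 < delta < 1 ->
    forall m : nat,
      c * delta ^- 2 * q ^+ 2 * H `^ q * N%:R <= m%:R ->
      (forall (dT : measure_display) (T : measurableType dT)
              (P : probability T R) (xi : 'I_m -> T -> Rd R d),
          (forall j, measurable_fun setT (xi j)) ->
          (forall j (B : set (Rd R d)), measurable B ->
              P (xi j @^-1` B) = mu B) ->
          mutually_independent P xi ->
          exists A : set T, measurable A /\ ((1 - delta)%:E <= P A)%E /\
            forall t, A t -> forall a : 'I_N -> R,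
              2^-1 * qnorm mu Omega q (lincomb phi a) `^ q
                <= m%:R^-1 * \sum_(j < m) `|lincomb phi a (xi j t)| `^ q
              /\ m%:R^-1 * \sum_(j < m) `|lincomb phi a (xi j t)| `^ q
                <= 3 / 2 * qnorm mu Omega q (lincomb phi a) `^ q)
      /\
      (exists pts : 'I_m -> 'rV[R]_d, (forall j, Omega (pts j)) /\
         forall a : 'I_N -> R,
           2^-1 * qnorm mu Omega q (lincomb phi a) `^ q
             <= m%:R^-1 * \sum_(j < m) `|lincomb phi a (pts j)| `^ q
           /\ m%:R^-1 * \sum_(j < m) `|lincomb phi a (pts j)| `^ q
             <= 3 / 2 * qnorm mu Omega q (lincomb phi a) `^ q).
Proof.
(* 256 is the Chernoff rate; 402 = 400 + 2 adds the exponents of the net size and of the 2/delta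
   term. *)
exists (256 * 402); split; first by rewrite mulr_gt0.
move=> d Om mu N phi q H delta cOm muOm cphi indep_phi q2 H0 LH delta01 m hm.
have mOm := compact_measurable_Rd cOm.
have q0 : 0 < q by lra.
have qn0 : q != 0 by rewrite gt_eqF.
have qnormE f : qnorm mu Om q f `^ q = Lq_pow mu (Om : set (Rd R d)) q f.
  by rewrite /qnorm powRVK // Lq_pow_ge0.
(* In dimension 0 the hypothesis allows m = 0, but every function is zero and all terms of the band
   vanish. *)
case: N phi cphi indep_phi LH hm => [|N] phi cphi indep_phi LH hm.
  have lin0 (a : 'I_0 -> R) : lincomb phi a = fun=> 0.
    by apply/funext => x; rewrite /lincomb big_ord0.
  have trivial_band (y : 'I_m -> 'rV[R]_d) (a : 'I_0 -> R) :
      2^-1 * qnorm mu Om q (lincomb phi a) `^ q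
        <= m%:R^-1 * \sum_(j < m) `|lincomb phi a (y j)| `^ q
      /\ m%:R^-1 * \sum_(j < m) `|lincomb phi a (y j)| `^ q
        <= 3 / 2 * qnorm mu Om q (lincomb phi a) `^ q.
    rewrite qnormE lin0 /Lq_pow normr0 powR0 // integral0 /= !mulr0.
    by rewrite big1 ?mulr0.
  split.
    move=> dT T P xi _ _ _; exists setT; split=> //; split.
      by rewrite probability_setT lee_fin; case/andP: delta01; lra.
    by move=> t _ a; exact: trivial_band.
  have [x0 x0O] : Om !=set0.
    apply/set0P/eqP => Om0; move: muOm; rewrite Om0 measure0 => /eqP.
    by rewrite eq_sym onee_eq0.
  by exists (fun=> x0); split=> // a; exact: trivial_band.
pose L (v : 'rV[R]_N.+1) : Rd R d -> R := lincomb phi (v ord0).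
have linL : is_linear_family L := lincomb_linear phi.
have mL v : measurable_fun (Om : set (Rd R d)) (L v).
  rewrite /L /lincomb; apply: measurable_sum => i; apply: measurable_funM => //.
  exact: continuous_measurable_Rd.
have LH' v x : Om x -> `|L v x| <= H * Lq_pow mu (Om : set (Rd R d)) q (L v) `^ q^-1.
  exact: LH.
have Ldef v : (forall x, Om x -> L v x = 0) -> v = 0.
  by move=> /indep_phi v0; apply/rowP => i; rewrite mxE v0.
have [S [sizeS SP]] := exists_sampling_tests mOm muOm linL mL Ldef (ltn0Sn N)
  q2 H0 LH' delta01 hm.
(* Both tails of every net point are tested. *)
pose tests := [seq (g, b) | g <- S, b <- [:: true; false]].
have size_tests : size tests = (size S * 2)%N by rewrite size_allpairs.
pose F (i : 'rV[R]_N.+1 * bool) := tail_test mu (Om : set (Rd R d)) q H (L i.1) i.2.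
have FP i := tail_test_props i.2 mOm (mL i.1) q0 H0 (LH' i.1).
have F0M i x : 0 <= F i x <= expR (1 + (H `^ q)^-1).
  by case: (FP i) => _ F01 _; exact: F01.
have mF i : measurable_fun setT (F i) by case: (FP i).
have FC i : (\int[mu]_x (F i x)%:E < (expR (- (H `^ q)^-1 / 256))%:E)%E.
  by case: (FP i).
have band y : (forall j, Om (y j)) ->
    {in tests, forall i, \prod_(j < m) F i (y j) < 1} ->
    forall a : 'I_N.+1 -> R,
      2^-1 * qnorm mu Om q (lincomb phi a) `^ q
        <= m%:R^-1 * \sum_(j < m) `|lincomb phi a (y j)| `^ q
      /\ m%:R^-1 * \sum_(j < m) `|lincomb phi a (y j)| `^ q
        <= 3 / 2 * qnorm mu Om q (lincomb phi a) `^ q.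
  move=> yO ytests a; rewrite qnormE.
  have -> : lincomb phi a = L (\row_i a i).
    by rewrite /L; congr lincomb; apply/funext => i; rewrite mxE.
  apply: SP => // g b gS; apply: (ytests (g, b)).
  by apply: allpairs_f => //; case: b.
split.
  move=> dT T P xi mxi lawxi indep.
  have [A [mA PA AP]] :=
    iid_all_prod_lt1 tests mOm muOm mF F0M FC mxi lawxi indep.
  exists A; split=> //; split.
    by apply: le_trans PA; rewrite lee_fin size_tests lerD2l lerN2.
  by move=> t /AP [tO tt] a; exact: band.
(* The same failure bound, at most delta < 1, feeds the derandomised choice. *)
have [||pts [ptsO ptests]] := @exists_points_prod_lt1 R _ (Rd R d) mu Om _ tests
  F (fun=> expR (- (H `^ q)^-1 / 256)) m mOm muOm mF _ FC.
- by move=> i x; case/andP: (F0M i x).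
- rewrite big_const_seq count_predT iter_addr_0 size_tests.
  rewrite -[_ *+ (_ * 2)]mulr_natl.
  by apply: (le_lt_trans sizeS); case/andP: delta01.
by exists pts; split=> // a; exact: band.
Qed.
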